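(* Let $(\mathcal C,p)$ and $(\mathcal C',p')$ be universe categories each equipped with a locally cartesian closed structure and a binary product structure, and let ${\bf\Phi}=(\Phi,\phi,\widetilde\phi):(\mathcal C,p)\to(\mathcal C',p')$ be a universe category functor (no compatibility of $\Phi$ with the locally cartesian closed or binary product structures is assumed). Let $n\ge0$, $X,Y\in\mathcal C$ and $d\in D_p^n(X,Y)$. Then $$\eta_n({\bf\Phi}^n(d))=\Phi(\eta_n(d))\circ\chi_{{\bf\Phi},n}(Y).$$
   Context: Conventions. Composition is written in diagrammatic order: for $f:X\to Y$, $g:Y\to Z$ the composite is $f\circ g:X\to Z$. $\amalg_{i\in I}A_i$ denotes the set of pairs $(i,a)$, $i\in I$, $a\in A_i$. All constructions below for $(\mathcal C,p)$ are applied also to $(\mathcal C',p')$. Universes. A universe in a category $\mathcal C$ is a morphism $p:\widetilde U\to U$ with a choice, for every $F:X\to U$, of a pullback square with vertex $(X;F)$ and projections $p_F:(X;F)\to X$, $Q(F):(X;F)\to\widetilde U$, $p_F\circ F=Q(F)\circ p$. For $f:X'\to X$ and $F:X\to U$, $Q(f,F):(X';f\circ F)\to(X;F)$ is the unique morphism with $Q(f,F)\circ p_F=p_{f\circ F}\circ f$ and $Q(f,F)\circ Q(F)=Q(f\circ F)$. A universe category $(\mathcal C,p)$ is a category with a universe $p$ and a chosen final object $pt$. Sets $D_p^n(X,Y)$. $D_p^0(X,Y)=Mor_{\mathcal C}(X,Y)$ and $D_p^{n}(X,Y)=\amalg_{F:X\to U}D_p^{n-1}((X;F),Y)$ for $n\ge1$.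 For $d\in D_p^n(X,Y)$, $f:X'\to X$, $g:Y\to Y'$, elements $f\circ d\in D_p^n(X',Y)$ and $d\circ g\in D_p^n(X,Y')$ are given by composition in $\mathcal C$ for $n=0$ and, for $n\ge1$, by $f\circ(F,a)=(f\circ F,Q(f,F)\circ a)$, $(F,a)\circ g=(F,a\circ g)$. Locally cartesian closed structure, $I_p$ and $\eta_n$. A binary product structure on $\mathcal C$ is a choice of binary products $X\times Y$ with projections $pr_1,pr_2$. A locally cartesian closed structure is a choice, in each slice $\mathcal C/Z$, of binary products $(X,f)\times_Z(Y,g)$ and of internal-hom objects $\underline{Hom}_Z((X,f),(Y,g))$ with evaluation morphisms $ev:\underline{Hom}_Z((X,f),(Y,g))\times_Z(X,f)\to(Y,g)$ such that $u\mapsto(u\times_Z Id)\circ ev$ is a bijection $Mor_Z((W,h),\underline{Hom}_Z((X,f),(Y,g)))\to Mor_Z((W,h)\times_Z(X,f),(Y,g))$; for $b:(Y,g)\to(Y',g')$ over $Z$, $\underline{Hom}_Z((X,f),b)$ is the unique morphism over $Z$ with $(\underline{Hom}_Z((X,f),b)\times_Z Id)\circ ev=ev\circ b$. Set $I_p(Y)=\underline{Hom}_U((\widetilde U,p),(U\times Y,pr_1))$, with structure morphism $prI_p(Y):I_p(Y)\to U$ and evaluation $evI_p(Y):(I_p(Y),prI_p(Y))\times_U(\widetilde U,p)\to U\times Y$; for $f:Y\to Y'$, $I_p(f)=\underline{Hom}_U((\widetilde U,p),Id_U\times f)$. This makes $I_p$ a functor $\mathcal C\to\mathcal C$; $I_p^n$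 is its $n$-th iterate. For $F:X\to U$ let $\iota_F:(X;F)\to(X,F)\times_U(\widetilde U,p)$ be the unique morphism with $\iota_F\circ pr_1=p_F$, $\iota_F\circ pr_2=Q(F)$. Set $st_p(Y)=\iota_{prI_p(Y)}\circ evI_p(Y)\circ pr_2:(I_p(Y);prI_p(Y))\to Y$. The function $Mor_{\mathcal C}(X,I_p(Y))\to D_p^1(X,Y)$, $g\mapsto(g\circ prI_p(Y),Q(g,prI_p(Y))\circ st_p(Y))$, is a bijection; $\eta_{1,Y,X}$ denotes its inverse. Bijections $\eta_{n,Y,X}:D_p^n(X,Y)\to Mor_{\mathcal C}(X,I_p^n(Y))$ are given by $\eta_{0,Y,X}=Id$ and $\eta_{n+1,Y,X}(F,a)=\eta_{1,I_p^n(Y),X}(F,\eta_{n,Y,(X;F)}(a))$; indices $Y,X$ are omitted. Set $Id^n_Y=\eta_n^{-1}(Id_{I_p^n(Y)})\in D_p^n(I_p^n(Y),Y)$. Universe category functors. A universe category functor ${\bf\Phi}=(\Phi,\phi,\widetilde\phi):(\mathcal C,p)\to(\mathcal C',p')$ (with $p:\widetilde U\to U$, $p':\widetilde U'\to U'$) consists of a functor $\Phi:\mathcal C\to\mathcal C'$ and morphisms $\phi:\Phi(U)\to U'$, $\widetilde\phi:\Phi(\widetilde U)\to\widetilde U'$ such that $\Phi(pt)$ is final, $\Phi$ takes the chosen pullback squares of the universe $p$ to pullback squares, and the square $\widetilde\phi\circ p'=\Phi(p)\circ\phi$ is a pullback. For $F:X\to U$, $\iota_{\bf\Phi}^{X,F}:(\Phi(X);\Phi(F)\circ\phi)\to\Phi((X;F))$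 is the unique morphism (an isomorphism) with $\iota_{\bf\Phi}^{X,F}\circ\Phi(p_F)=p_{\Phi(F)\circ\phi}$ and $\iota_{\bf\Phi}^{X,F}\circ\Phi(Q(F))\circ\widetilde\phi=Q(\Phi(F)\circ\phi)$. Functions ${\bf\Phi}^n:D_p^n(X,Y)\to D_{p'}^n(\Phi(X),\Phi(Y))$ are given by ${\bf\Phi}^0(f)=\Phi(f)$ and ${\bf\Phi}^n((F,a))=(\Phi(F)\circ\phi,\iota_{\bf\Phi}^{X,F}\circ{\bf\Phi}^{n-1}(a))$ for $n\ge1$. Finally, $\chi_{{\bf\Phi},n}(Y)=\eta_n({\bf\Phi}^n(Id^n_Y)):\Phi(I_p^n(Y))\to I_{p'}^n(\Phi(Y))$. *)

(* Defs.v *)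
From mathcomp Require Import all_boot boolp.

Set Implicit Arguments.
Unset Strict Implicit.
Unset Printing Implicit Defensive.

Definition the (T : Type) (P : T -> Prop) (h : exists! x, P x) : T :=
  projT1 (cid h).

Lemma theP (T : Type) (P : T -> Prop) (h : exists! x, P x) : P (the h).
Proof. exact: (proj1 (projT2 (cid h))). Qed.

Lemma the_eq (T : Type) (P : T -> Prop) (h : exists! x, P x) x :
  P x -> the h = x.
Proof.
by move=> Px; have [y [_ Uy]] := h; rewrite -(Uy _ Px) -(Uy _ (theP h)).
Qed.

Lemma bij_inv_ex (A B : Type) (f : A -> B) :
  bijective f -> exists g : B -> A, cancel f g /\ cancel g f.
Proof. by case=> g fK gK; exists g. Qed.

Definition bij_inv (A B : Type) (f : A -> B) (h : bijective f) : B -> A :=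
  projT1 (cid (bij_inv_ex h)).

Lemma bij_invK (A B : Type) (f : A -> B) (h : bijective f) :
  cancel f (bij_inv h).
Proof. exact: (proj1 (projT2 (cid (bij_inv_ex h)))). Qed.

Lemma bij_invKV (A B : Type) (f : A -> B) (h : bijective f) :
  cancel (bij_inv h) f.
Proof. exact: (proj2 (projT2 (cid (bij_inv_ex h)))). Qed.

(* Composition is in diagrammatic order: [f ;; g] is first f, then g. *)
Reserved Notation "f ;; g" (at level 50, left associativity).

Record category := Category {
  Ob :> Type;
  Hom : Ob -> Ob -> Type;
  idm : forall X, Hom X X;
  compm : forall X Y Z, Hom X Y -> Hom Y Z -> Hom X Z
    where "f ;; g" := (compm f g);
  compm1 : forall X Y (f : Hom X Y), f ;; idm Y = f;
  comp1m : forall X Y (f : Hom X Y), idm X ;; f = f;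
  compmA : forall X Y Z W (f : Hom X Y) (g : Hom Y Z) (h : Hom Z W),
    f ;; (g ;; h) = f ;; g ;; h
}.
Arguments Hom {c} X Y.
Arguments idm {c} X.
Notation "f ;; g" := (compm f g).

Definition is_final (C : category) (X : C) : Prop :=
  forall W : C, exists! f : Hom W X, True.

(* The square with vertex P, projections a, b and sides f, g is a pullback. *)
Definition is_pullback (C : category) (P A B Z : C)
    (a : Hom P A) (b : Hom P B) (f : Hom A Z) (g : Hom B Z) : Prop :=
  a ;; f = b ;; g /\
  forall (W : C) (u : Hom W A) (v : Hom W B), u ;; f = v ;; g ->
    exists! w : Hom W P, w ;; a = u /\ w ;; b = v.

Record functor (C D : category) := Functor {
  fobj :> C -> D;
  fmap : forall X Y : C, Hom X Y -> Hom (fobj X) (fobj Y);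
  fmap1 : forall X : C, fmap (idm X) = idm (fobj X);
  fmapM : forall (X Y Z : C) (f : Hom X Y) (g : Hom Y Z),
    fmap (f ;; g) = fmap f ;; fmap g
}.
Arguments fmap {C D} _ {X Y}.

Definition functor_id (C : category) : functor C C :=
  @Functor C C id (fun _ _ f => f) (fun _ => erefl) (fun _ _ _ _ _ => erefl).

Definition functor_comp (C D E : category) (F : functor C D) (G : functor D E) :
  functor C E.
Proof.
refine (@Functor C E (fun X => G (F X)) (fun _ _ f => fmap G (fmap F f)) _ _).
- by move=> X; rewrite !fmap1.
- by move=> X Y Z f g; rewrite !fmapM.
Defined.

Fixpoint functor_iter (C : category) (n : nat) (F : functor C C) :
    functor C C :=
  if n is m.+1 then functor_comp (functor_iter m F) F else functor_id C.

Record slice_ob (C : category) (Z : C) := SliceOb {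
  sdom : C;
  sstr : Hom sdom Z
}.
Arguments SliceOb {C Z sdom} sstr.

Record slice_hom (C : category) (Z : C) (A B : slice_ob Z) := SliceHom {
  smor : Hom (sdom A) (sdom B);
  smor_str : smor ;; sstr B = sstr A
}.

Lemma slice_hom_eq (C : category) (Z : C) (A B : slice_ob Z)
  (f g : slice_hom A B) : smor f = smor g -> f = g.
Proof.
case: f g => [f hf] [g hg] /= E; case: _ / E hg => hg.
by rewrite (Prop_irrelevance hf hg).
Qed.

Lemma slice_id_str (C : category) (Z : C) (A : slice_ob Z) :
  idm (sdom A) ;; sstr A = sstr A.
Proof. exact: comp1m. Qed.

Lemma slice_comp_str (C : category) (Z : C) (A B D : slice_ob Z)
  (f : slice_hom A B) (g : slice_hom B D) :
  smor f ;; smor g ;; sstr D = sstr A.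
Proof. by rewrite -compmA !smor_str. Qed.

Definition slice (C : category) (Z : C) : category.
Proof.
refine (@Category (slice_ob Z) (@slice_hom C Z)
  (fun A => SliceHom (slice_id_str A))
  (fun A B D f g => SliceHom (slice_comp_str f g)) _ _ _).
- by move=> A B f; apply: slice_hom_eq; exact: compm1.
- by move=> A B f; apply: slice_hom_eq; exact: comp1m.
- by move=> A B D E f g h; apply: slice_hom_eq; exact: compmA.
Defined.

Record binary_products (C : category) := BinaryProducts {
  bprod : C -> C -> C;
  bpr1 : forall X Y, Hom (bprod X Y) X;
  bpr2 : forall X Y, Hom (bprod X Y) Y;
  bprodP : forall (W X Y : C) (f : Hom W X) (g : Hom W Y),
    exists! h : Hom W (bprod X Y), h ;; bpr1 X Y = f /\ h ;; bpr2 X Y = g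
}.
Arguments bprod {C} b X Y.
Arguments bpr1 {C} b X Y.
Arguments bpr2 {C} b X Y.

Section BinaryProducts.
Context (C : category) (B : binary_products C).

Definition bpair (W X Y : C) (f : Hom W X) (g : Hom W Y) :
  Hom W (bprod B X Y) := the (bprodP B f g).

Definition bmap (X X' Y Y' : C) (f : Hom X X') (g : Hom Y Y') :
  Hom (bprod B X Y) (bprod B X' Y') := bpair (bpr1 B X Y ;; f) (bpr2 B X Y ;; g).

Lemma bpair1 (W X Y : C) (f : Hom W X) (g : Hom W Y) :
  bpair f g ;; bpr1 B X Y = f.
Proof. exact: (proj1 (theP (bprodP B f g))). Qed.

Lemma bpair2 (W X Y : C) (f : Hom W X) (g : Hom W Y) :
  bpair f g ;; bpr2 B X Y = g.
Proof. exact: (proj2 (theP (bprodP B f g))). Qed.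

Lemma bprod_ext (W X Y : C) (h k : Hom W (bprod B X Y)) :
  h ;; bpr1 B X Y = k ;; bpr1 B X Y -> h ;; bpr2 B X Y = k ;; bpr2 B X Y ->
  h = k.
Proof.
move=> e1 e2.
have [z [_ Uz]] := bprodP B (k ;; bpr1 B X Y) (k ;; bpr2 B X Y).
by rewrite -(Uz h) // -(Uz k).
Qed.

Lemma bmap1 (X X' Y Y' : C) (f : Hom X X') (g : Hom Y Y') :
  bmap f g ;; bpr1 B X' Y' = bpr1 B X Y ;; f.
Proof. exact: bpair1. Qed.

Lemma bmap2 (X X' Y Y' : C) (f : Hom X X') (g : Hom Y Y') :
  bmap f g ;; bpr2 B X' Y' = bpr2 B X Y ;; g.
Proof. exact: bpair2. Qed.

Lemma bmap_id (X Y : C) : bmap (idm X) (idm Y) = idm (bprod B X Y).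
Proof.
by apply: bprod_ext; rewrite ?bmap1 ?bmap2 comp1m compm1.
Qed.

Lemma bmapM (X X' X'' Y Y' Y'' : C) (f : Hom X X') (f' : Hom X' X'')
  (g : Hom Y Y') (g' : Hom Y' Y'') :
  bmap (f ;; f') (g ;; g') = bmap f g ;; bmap f' g'.
Proof.
apply: bprod_ext; rewrite -compmA ?bmap1 ?bmap2 !compmA ?bmap1 ?bmap2 //.
Qed.

End BinaryProducts.

Record internal_homs (C : category) (B : binary_products C) := InternalHoms {
  ihom : C -> C -> C;
  ihom_ev : forall X Y, Hom (bprod B (ihom X Y) X) Y;
  ihom_bij : forall W X Y : C,
    bijective (fun u : Hom W (ihom X Y) => bmap B u (idm X) ;; ihom_ev X Y)
}.
Arguments ihom {C B} i X Y.
Arguments ihom_ev {C B} i X Y.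

Section InternalHoms.
Context (C : category) (B : binary_products C) (H : internal_homs B).

Lemma ihom_map_ex (X Y Y' : C) (b : Hom Y Y') :
  exists! v : Hom (ihom H X Y) (ihom H X Y'),
    bmap B v (idm X) ;; ihom_ev H X Y' = ihom_ev H X Y ;; b.
Proof.
have [g fK gK] := ihom_bij H (ihom H X Y) X Y'.
exists (g (ihom_ev H X Y ;; b)); split; first exact: gK.
by move=> v <-; rewrite fK.
Qed.

Definition ihom_map (X Y Y' : C) (b : Hom Y Y') :
  Hom (ihom H X Y) (ihom H X Y') := the (ihom_map_ex X b).

Lemma ihom_map_id (X Y : C) : ihom_map X (idm Y) = idm (ihom H X Y).
Proof. by apply: the_eq; rewrite bmap_id comp1m compm1. Qed.

Lemma ihom_mapM (X Y Y' Y'' : C) (b : Hom Y Y') (b' : Hom Y' Y'') :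
  ihom_map X (b ;; b') = ihom_map X b ;; ihom_map X b'.
Proof.
apply: the_eq; rewrite -[in LHS](compm1 (idm X)) bmapM -compmA.
by rewrite (theP (ihom_map_ex X b')) !compmA (theP (ihom_map_ex X b)).
Qed.

End InternalHoms.

Record lcc_structure (C : category) := LccStructure {
  lcc_prod : forall Z : C, binary_products (slice Z);
  lcc_hom : forall Z : C, internal_homs (lcc_prod Z)
}.

Record universe (C : category) := Universe {
  utot : C;
  ubase : C;
  umor : Hom utot ubase;
  uext : forall X : C, Hom X ubase -> C;
  upr : forall (X : C) (F : Hom X ubase), Hom (uext F) X;
  uQ : forall (X : C) (F : Hom X ubase), Hom (uext F) utot;
  uext_pb : forall (X : C) (F : Hom X ubase),
    is_pullback (upr F) (uQ F) F umor
}.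
Arguments uext {C u X} F.
Arguments upr {C u X} F.
Arguments uQ {C u X} F.

Record universe_category := UniverseCategory {
  uc_cat :> category;
  uc_universe :> universe uc_cat;
  uc_pt : uc_cat;
  uc_pt_final : is_final uc_pt
}.

Section Universe.
Context (C : category) (p : universe C).
Local Notation U := (ubase p).

Lemma uext_sq (X : C) (F : Hom X U) : upr F ;; F = uQ F ;; umor p.
Proof. exact: (proj1 (uext_pb F)). Qed.

Lemma uext_ext (W X : C) (F : Hom X U) (h k : Hom W (uext F)) :
  h ;; upr F = k ;; upr F -> h ;; uQ F = k ;; uQ F -> h = k.
Proof.
move=> e1 e2; have [sq UP] := uext_pb F.
have E : k ;; upr F ;; F = k ;; uQ F ;; umor p by rewrite -!compmA sq.
by have [z [_ Uz]] := UP _ _ _ E; rewrite -(Uz h) // -(Uz k).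
Qed.

Lemma uQmap_ex (X' X : C) (f : Hom X' X) (F : Hom X U) :
  exists! q : Hom (uext (f ;; F)) (uext F),
    q ;; upr F = upr (f ;; F) ;; f /\ q ;; uQ F = uQ (f ;; F).
Proof. by apply: (proj2 (uext_pb F)); rewrite -compmA uext_sq. Qed.

Definition uQmap (X' X : C) (f : Hom X' X) (F : Hom X U) :
  Hom (uext (f ;; F)) (uext F) := the (uQmap_ex f F).

Fixpoint D (n : nat) (X Y : C) : Type :=
  if n is m.+1 then {F : Hom X U & D m (uext F) Y} else Hom X Y.

Fixpoint D_precomp (n : nat) (X' X Y : C) (f : Hom X' X) :
    D n X Y -> D n X' Y :=
  match n return D n X Y -> D n X' Y with
  | 0 => fun d => f ;; d
  | m.+1 => fun d =>
      existT (fun F : Hom X' U => D m (uext F) Y) (f ;; projT1 d)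
        (D_precomp (uQmap f (projT1 d)) (projT2 d))
  end.

Section Ip.
Context (L : lcc_structure C) (B : binary_products C).

Definition slice_Ut : slice U := SliceOb (umor p).

Definition slice_UxY (Y : C) : slice U := SliceOb (bpr1 B U Y).

Definition slice_Ip (Y : C) : slice U :=
  ihom (lcc_hom L U) slice_Ut (slice_UxY Y).

Definition Ip_ob (Y : C) : C := sdom (slice_Ip Y).

Definition prIp (Y : C) : Hom (Ip_ob Y) U := sstr (slice_Ip Y).

Definition evIp (Y : C) :
  Hom (sdom (bprod (lcc_prod L U) (slice_Ip Y) slice_Ut)) (bprod B U Y) :=
  smor (ihom_ev (lcc_hom L U) slice_Ut (slice_UxY Y)).

Lemma slice_UxY_map_str (Y Y' : C) (f : Hom Y Y') :
  bmap B (idm U) f ;; sstr (slice_UxY Y') = sstr (slice_UxY Y).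
Proof. by rewrite /= bmap1 compm1. Qed.

Definition slice_UxY_map (Y Y' : C) (f : Hom Y Y') :
  Hom (slice_UxY Y) (slice_UxY Y') :=
  @SliceHom C U (slice_UxY Y) (slice_UxY Y') _ (slice_UxY_map_str f).

Definition Ip : functor C C.
Proof.
refine (@Functor C C Ip_ob
  (fun Y Y' f => smor (ihom_map (lcc_hom L U) slice_Ut (slice_UxY_map f))) _ _).
- move=> Y; suff -> : slice_UxY_map (idm Y) = idm (slice_UxY Y).
    by rewrite ihom_map_id.
  by apply: slice_hom_eq; rewrite /= bmap_id.
- move=> X Y Z f g.
  suff -> : slice_UxY_map (f ;; g) = slice_UxY_map f ;; slice_UxY_map g.
    by rewrite ihom_mapM.
  by apply: slice_hom_eq; rewrite /= -[X in bmap _ X](compm1 (idm U)) bmapM.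
Defined.

(* The pair (X, F : X -> U) is a single object A of the slice over U, so that
   F is [sstr A] and (X; F) is [uext (sstr A)]. *)
Lemma iota_ex (A : slice U) :
  exists! i : Hom (uext (sstr A)) (sdom (bprod (lcc_prod L U) A slice_Ut)),
    i ;; smor (bpr1 (lcc_prod L U) A slice_Ut) = upr (sstr A) /\
    i ;; smor (bpr2 (lcc_prod L U) A slice_Ut) = uQ (sstr A).
Proof.
pose E : slice U := SliceOb (upr (sstr A) ;; sstr A).
have h2 : uQ (sstr A) ;; umor p = upr (sstr A) ;; sstr A by rewrite uext_sq.
pose a : Hom E A := @SliceHom C U E A (upr (sstr A)) erefl.
pose b : Hom E slice_Ut := @SliceHom C U E slice_Ut (uQ (sstr A)) h2.
have [i [[i1 i2] Ui]] := bprodP (lcc_prod L U) a b.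
exists (smor i); split; first by split; [rewrite -[RHS]/(smor a) -i1|
  rewrite -[RHS]/(smor b) -i2].
move=> j [j1 j2].
have hj : j ;; sstr (bprod (lcc_prod L U) A slice_Ut) = sstr E.
  by rewrite -(smor_str (bpr1 (lcc_prod L U) A slice_Ut)) compmA j1.
rewrite (Ui (@SliceHom C U E _ j hj)) //.
by split; apply: slice_hom_eq.
Qed.

Definition iota_F (A : slice U) :
  Hom (uext (sstr A)) (sdom (bprod (lcc_prod L U) A slice_Ut)) :=
  the (iota_ex A).

Definition st (Y : C) : Hom (uext (prIp Y)) Y :=
  iota_F (slice_Ip Y) ;; evIp Y ;; bpr2 B U Y.

Definition D1_of_mor (X Y : C) (g : Hom X (Ip Y)) : D 1 X Y :=
  existT (fun F : Hom X U => Hom (uext F) Y) (g ;; prIp Y)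
    (uQmap g (prIp Y) ;; st Y).

Section D1Bijective.
Context (X Y : C).

Let sprod (A : slice U) := bprod (lcc_prod L U) A slice_Ut.

(* [D1_of_mor] on the morphisms g with g ;; prIp Y = F; see [D1_of_morE]. *)
Definition D1_theta (F : Hom X U) (g : slice_hom (SliceOb F) (slice_Ip Y)) :
    Hom (uext F) Y :=
  iota_F (SliceOb F) ;;
  smor (bmap (lcc_prod L U) (g : Hom (SliceOb F : slice U) _) (idm slice_Ut)
        ;; ihom_ev (lcc_hom L U) slice_Ut (slice_UxY Y)) ;;
  bpr2 B U Y.

Lemma iota_F1 (A : slice U) :
  iota_F A ;; smor (bpr1 (lcc_prod L U) A slice_Ut) = upr (sstr A).
Proof. exact: (proj1 (theP (iota_ex A))). Qed.

Lemma iota_F2 (A : slice U) :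
  iota_F A ;; smor (bpr2 (lcc_prod L U) A slice_Ut) = uQ (sstr A).
Proof. exact: (proj2 (theP (iota_ex A))). Qed.

Lemma iota_F_inv (A : slice U) :
  exists j : Hom (sdom (sprod A)) (uext (sstr A)),
    iota_F A ;; j = idm _ /\ j ;; iota_F A = idm _.
Proof.
have sq : smor (bpr1 (lcc_prod L U) A slice_Ut) ;; sstr A =
    smor (bpr2 (lcc_prod L U) A slice_Ut) ;; umor p.
  by rewrite smor_str (smor_str (bpr2 (lcc_prod L U) A slice_Ut)).
have [j [[j1 j2] _]] := proj2 (uext_pb (sstr A)) _ _ _ sq.
exists j; split.
  by apply: uext_ext; rewrite -compmA ?j1 ?j2 ?iota_F1 ?iota_F2 comp1m.
have hj : j ;; iota_F A ;; sstr (sprod A) = sstr (sprod A).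
  rewrite -{1}(smor_str (bpr1 (lcc_prod L U) A slice_Ut)) !compmA.
  by rewrite -(compmA j) iota_F1 j1 smor_str.
suff : (SliceHom hj : Hom (sprod A) (sprod A)) = idm (sprod A).
  by move/(congr1 (@smor _ _ _ _)).
by apply: bprod_ext; apply: slice_hom_eq;
  rewrite /= -compmA ?iota_F1 ?iota_F2 ?j1 ?j2 comp1m.
Qed.

Lemma D1_theta_bij (F : Hom X U) : bijective (@D1_theta F).
Proof.
pose A : slice U := SliceOb F.
have [g fK gK] := ihom_bij (lcc_hom L U) A slice_Ut (slice_UxY Y).
have [j [ij ji]] := iota_F_inv A.
have hs (a : Hom (uext F) Y) :
    bpair B (sstr (sprod A)) (j ;; a) ;; sstr (slice_UxY Y) = sstr (sprod A).
  exact: bpair1.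
pose s a : Hom (sprod A) (slice_UxY Y) :=
  @SliceHom C U (sprod A) (slice_UxY Y) _ (hs a).
exists (fun a => g (s a)) => [u|a].
  rewrite -[RHS]fK; congr g; apply: slice_hom_eq; rewrite /D1_theta.
  set k := (_ ;; _ : Hom (sprod A) (slice_UxY Y)).
  apply: bprod_ext; first by rewrite /= bpair1 -(smor_str k).
  by rewrite /= bpair2 !compmA ji comp1m.
have := gK (s a); rewrite /D1_theta => ->.
by rewrite /= -compmA bpair2 compmA ij comp1m.
Qed.

Lemma D1_of_morE (F : Hom X U) (g : slice_hom (SliceOb F) (slice_Ip Y)) :
  D1_of_mor (smor g : Hom X (Ip Y)) = existT _ F (D1_theta g).
Proof.
case: g => g e; rewrite /= in g e *; case: _ / e.
rewrite /D1_of_mor; congr existT; rewrite /D1_theta /st !compmA; congr (_ ;; _).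
congr (_ ;; _).
set gs := (gs in bmap _ gs _); set m := bmap _ _ _.
set i := iota_F (SliceOb _).
set q := uQmap _ _.
have [q1 q2] : q ;; upr (prIp Y) = upr (g ;; prIp Y) ;; g /\
  q ;; uQ (prIp Y) = uQ (g ;; prIp Y) := theP (uQmap_ex g (prIp Y)).
have [j [ij ji]] := iota_F_inv (slice_Ip Y).
suff -> : q = i ;; smor m ;; j by rewrite -!compmA ji compm1.
have jr : j ;; upr (sstr (slice_Ip Y)) =
    smor (bpr1 (lcc_prod L U) (slice_Ip Y) slice_Ut).
  by rewrite -iota_F1 compmA ji comp1m.
have jQ : j ;; uQ (sstr (slice_Ip Y)) =
    smor (bpr2 (lcc_prod L U) (slice_Ip Y) slice_Ut).
  by rewrite -iota_F2 compmA ji comp1m.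
apply: uext_ext.
- rewrite q1 -!compmA jr.
  have /(congr1 (@smor _ _ _ _)) /= -> :=
    bmap1 (lcc_prod L U) gs (idm slice_Ut).
  rewrite /= compmA; congr (_ ;; _); symmetry.
  exact: (iota_F1 (SliceOb (g ;; prIp Y))).
- rewrite q2 -!compmA jQ.
  have /(congr1 (@smor _ _ _ _)) /= -> :=
    bmap2 (lcc_prod L U) gs (idm slice_Ut).
  rewrite compm1; symmetry.
  exact: (iota_F2 (SliceOb (g ;; prIp Y))).
Qed.

Lemma D1_of_mor_bij : bijective (@D1_of_mor X Y).
Proof.
pose h (d : D 1 X Y) : Hom X (Ip Y) :=
  smor (bij_inv (D1_theta_bij (projT1 d)) (projT2 d)).
exists h => [g|[F a]].
  pose u : slice_hom (SliceOb (g ;; prIp Y)) (slice_Ip Y) :=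
    @SliceHom C U (SliceOb (g ;; prIp Y)) (slice_Ip Y) g erefl.
  by rewrite (D1_of_morE u) /h /= bij_invK.
by rewrite /h D1_of_morE bij_invKV.
Qed.

End D1Bijective.

Definition eta1 (X Y : C) : D 1 X Y -> Hom X (Ip Y) :=
  bij_inv (D1_of_mor_bij X Y).

Lemma eta1_bij (X Y : C) : bijective (@eta1 X Y).
Proof. by exists (@D1_of_mor X Y); [exact: bij_invKV | exact: bij_invK]. Qed.

Fixpoint eta (n : nat) (X Y : C) : D n X Y -> Hom X (functor_iter n Ip Y) :=
  match n return D n X Y -> Hom X (functor_iter n Ip Y) with
  | 0 => fun d => d
  | m.+1 => fun d => @eta1 X (functor_iter m Ip Y)
      (existT (fun F : Hom X U => Hom (uext F) (functor_iter m Ip Y))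
         (projT1 d) (@eta m (uext (projT1 d)) Y (projT2 d)))
  end.

Lemma eta_bij (n : nat) (X Y : C) : bijective (@eta n X Y).
Proof.
elim: n X => [|n IH] X; first by exists id.
have [h fK gK] := eta1_bij X (functor_iter n Ip Y).
exists (fun g => existT (fun F : Hom X U => D n (uext F) Y) (projT1 (h g))
  (bij_inv (IH (uext (projT1 (h g)))) (projT2 (h g)))) => [[F a]|g].
  by rewrite [eta _]/= fK /= bij_invK.
rewrite [LHS]/= bij_invKV -[RHS]gK; congr eta1.
by case: (h g).
Qed.

Definition IdD (n : nat) (Y : C) : D n (functor_iter n Ip Y) Y :=
  bij_inv (eta_bij n (functor_iter n Ip Y) Y) (idm (functor_iter n Ip Y)).

End Ip.
End Universe.

Record universe_functor (C C' : universe_category) := UniverseFunctor {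
  uf_functor :> functor C C';
  uf_phi : Hom (uf_functor (ubase C)) (ubase C');
  uf_phit : Hom (uf_functor (utot C)) (utot C');
  uf_pt : is_final (uf_functor (uc_pt C));
  uf_ext_pb : forall (X : C) (F : Hom X (ubase C)),
    is_pullback (fmap uf_functor (upr F)) (fmap uf_functor (uQ F))
      (fmap uf_functor F) (fmap uf_functor (umor C));
  uf_pb : is_pullback (fmap uf_functor (umor C)) uf_phit uf_phi (umor C')
}.

Section UniverseFunctor.
Context (C C' : universe_category) (Phi : universe_functor C C').

Definition uf_base (X : C) (F : Hom X (ubase C)) : Hom (Phi X) (ubase C') :=
  fmap Phi F ;; uf_phi Phi.

Lemma uf_iota_ex (X : C) (F : Hom X (ubase C)) :
  exists! i : Hom (uext (uf_base F)) (Phi (uext F)),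
    i ;; fmap Phi (upr F) = upr (uf_base F) /\
    i ;; fmap Phi (uQ F) ;; uf_phit Phi = uQ (uf_base F).
Proof.
have [sq1 U1] := uf_ext_pb Phi F; have [sq2 U2] := uf_pb Phi.
have E : upr (uf_base F) ;; fmap Phi F ;; uf_phi Phi =
    uQ (uf_base F) ;; umor C' by rewrite -compmA -uext_sq.
have [k [[k1 k2] Uk]] := U2 _ _ _ E.
have [i [[i1 i2] Ui]] := U1 _ _ _ (esym k1).
exists i; split; first by rewrite i2.
move=> j [j1 j2]; apply: Ui; split=> //; symmetry; apply: Uk; split=> //.
by rewrite -compmA -sq1 compmA j1.
Qed.

Definition uf_iota (X : C) (F : Hom X (ubase C)) :
  Hom (uext (uf_base F)) (Phi (uext F)) := the (uf_iota_ex F).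

Fixpoint uf_D (n : nat) (X Y : C) : D C n X Y -> D C' n (Phi X) (Phi Y) :=
  match n return D C n X Y -> D C' n (Phi X) (Phi Y) with
  | 0 => fun d => fmap Phi d
  | m.+1 => fun d =>
      existT (fun F : Hom (Phi X) (ubase C') => D C' m (uext F) (Phi Y))
        (uf_base (projT1 d))
        (D_precomp (uf_iota (projT1 d)) (uf_D (projT2 d)))
  end.

Definition chi (L : lcc_structure C) (B : binary_products C)
    (L' : lcc_structure C') (B' : binary_products C') (n : nat) (Y : C) :
    Hom (Phi (functor_iter n (Ip C L B) Y))
      (functor_iter n (Ip C' L' B') (Phi Y)) :=
  eta L' B' (uf_D (IdD C L B n Y)).

End UniverseFunctor.

(* Main.v *)
From mathcomp Require Import all_boot.
Require Import Defs.

(** Once the three constructions involved are known to commute with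
    precomposition, the theorem is an instance of the Yoneda argument.  The
    bijections [eta] are natural in the source object ([eta_precomp]), so
    [eta d] represents [d]: every d is the pullback of the generic element
    [IdD] along [eta d] ([D_precomp_IdD]).  The action of Phi on D also
    commutes with precomposition ([uf_D_precomp]).  Applying it to
    d = eta d ;; IdD therefore gives Phi(eta d) ;; Phi^n(IdD), and a second use
    of the naturality of [eta], now in C', turns this into
    Phi(eta d) ;; chi.  Nothing relates Phi to the exponentials: these enter
    only through the two naturality statements for [eta].

    The one technical obstacle is that elements of D are dependent pairs whose
    first components agree only up to associativity of composition or
    functoriality of Phi, so that their second components live over distinct
    objects (X;F).  [D_pair_eq] deals with this once and for all: it replaces
    the transport along an equality F' = F by an arbitrary comparison morphism
    (X;F') -> (X;F) compatible with the projections, after which equalities of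
    second components are checked by the universal property of pullbacks. *)

Set Implicit Arguments.
Unset Strict Implicit.
Unset Printing Implicit Defensive.

Lemma pullback_ext (C : category) (P A B Z : C) (a : Hom P A) (b : Hom P B)
    (f : Hom A Z) (g : Hom B Z) (pb : is_pullback a b f g)
    (W : C) (h k : Hom W P) :
  h ;; a = k ;; a -> h ;; b = k ;; b -> h = k.
Proof.
case: pb => sq univ ea eb.
have E : k ;; a ;; f = k ;; b ;; g by rewrite -!compmA sq.
by have [z [_ Uz]] := univ _ _ _ E; rewrite -(Uz h) // -(Uz k).
Qed.

Section Precomposition.
Context (C : category) (p : universe C).

Lemma uQmap1 (X' X : C) (f : Hom X' X) (F : Hom X (ubase p)) :
  uQmap f F ;; upr F = upr (f ;; F) ;; f.
Proof. exact: (proj1 (theP (uQmap_ex f F))). Qed.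

Lemma uQmap2 (X' X : C) (f : Hom X' X) (F : Hom X (ubase p)) :
  uQmap f F ;; uQ F = uQ (f ;; F).
Proof. exact: (proj2 (theP (uQmap_ex f F))). Qed.

(** The comparison c is quantified over, rather than built as a transport of
    the identity along F' = F, because its two equations are all that a proof
    of h' = c ;; h by a universal property can use; once F' and F are
    identified, c may be taken to be the identity. *)
Lemma D_pair_eq (n : nat) (X Y Z : C) (F' F : Hom X (ubase p))
    (h' : Hom (uext F') Z) (h : Hom (uext F) Z) (a : D p n Z Y) :
  F' = F ->
  (forall c : Hom (uext F') (uext F),
     c ;; upr F = upr F' -> c ;; uQ F = uQ F' -> h' = c ;; h) ->
  existT (fun G : Hom X (ubase p) => D p n (uext G) Y) F' (D_precomp h' a) =
  existT (fun G : Hom X (ubase p) => D p n (uext G) Y) F (D_precomp h a).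
Proof.
move=> e; case: _ / e h => h hh.
by rewrite (hh (idm _)) ?comp1m.
Qed.

Lemma D_precompM (n : nat) (X'' X' X Y : C) (f : Hom X'' X') (g : Hom X' X)
    (d : D p n X Y) :
  D_precomp (f ;; g) d = D_precomp f (D_precomp g d).
Proof.
elim: n X'' X' X f g d => [|n IH] X'' X' X f g d /=; first by rewrite compmA.
rewrite -IH; apply: D_pair_eq => [|c c1 c2]; first by rewrite compmA.
apply: uext_ext.
- rewrite uQmap1 -(compmA c) -(compmA (uQmap f _)) uQmap1.
  by rewrite (compmA (uQmap f _)) uQmap1 2!(compmA c) c1 compmA.
- by rewrite uQmap2 -(compmA c) -(compmA (uQmap f _)) !uQmap2 c2.
Qed.

Section Eta.
Context (L : lcc_structure C) (B : binary_products C).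

(** The inverse of [eta1] sends g to the pullback along g of the single element
    (prIp, st), so its naturality is the functoriality of pullback. *)
Lemma eta1_precomp (X' X Y : C) (f : Hom X' X) (d : D p 1 X Y) :
  eta1 L B (D_precomp f d) = f ;; eta1 L B d.
Proof.
pose gen : D p 1 (Ip p L B Y) Y :=
  existT (fun F : Hom _ (ubase p) => Hom (uext F) Y) (prIp p L B Y) (st p L B Y).
have DE W (g : Hom W (Ip p L B Y)) : D1_of_mor g = D_precomp g gen by [].
rewrite -{1}[d](bij_invKV (D1_of_mor_bij p L B X Y)) -/(eta1 L B d).
by rewrite DE -D_precompM -DE; apply: bij_invK.
Qed.

Lemma eta_precomp (n : nat) (X' X Y : C) (f : Hom X' X) (d : D p n X Y) :
  eta L B (D_precomp f d) = f ;; eta L B d.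
Proof.
elim: n X' X f d => [//|n IH] X' X f d /=.
by rewrite IH -eta1_precomp.
Qed.

(** Yoneda: [IdD] is the universal element of the presheaf D n (-) Y, which
    [eta] represents. *)
Lemma D_precomp_IdD (n : nat) (X Y : C) (d : D p n X Y) :
  D_precomp (eta L B d) (IdD p L B n Y) = d.
Proof.
apply: (bij_inj (eta_bij p L B n X Y)).
by rewrite eta_precomp bij_invKV compm1.
Qed.

End Eta.
End Precomposition.

Section UniverseFunctor.
Context (C C' : universe_category) (Phi : universe_functor C C').

Lemma uf_iota1 (X : C) (F : Hom X (ubase C)) :
  uf_iota Phi F ;; fmap Phi (upr F) = upr (uf_base Phi F).
Proof. exact: (proj1 (theP (uf_iota_ex Phi F))). Qed.

Lemma uf_iota2 (X : C) (F : Hom X (ubase C)) :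
  uf_iota Phi F ;; fmap Phi (uQ F) ;; uf_phit Phi = uQ (uf_base Phi F).
Proof. exact: (proj2 (theP (uf_iota_ex Phi F))). Qed.

(** Pasting the image under Phi of the canonical square of F with the square of
    phi and phit exhibits Phi((X;F)) as a pullback of p'. *)
Lemma uf_ext_ext (W : C') (X : C) (F : Hom X (ubase C))
    (h k : Hom W (Phi (uext F))) :
  h ;; fmap Phi (upr F) = k ;; fmap Phi (upr F) ->
  h ;; fmap Phi (uQ F) ;; uf_phit Phi = k ;; fmap Phi (uQ F) ;; uf_phit Phi ->
  h = k.
Proof.
move=> e1 e2; apply: (pullback_ext (uf_ext_pb Phi F)) => //.
apply: (pullback_ext (uf_pb Phi)) => //.
by rewrite -!compmA -(proj1 (uf_ext_pb Phi F)) !compmA e1.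
Qed.

(** The content is the naturality of [uf_iota] under base change: the two
    morphisms into Phi((X;F)), one through Phi((X';f;;F)) and one through
    (Phi X;Phi F;;phi), have equal components
    in the sense of [uf_ext_ext]. *)
Lemma uf_D_precomp (n : nat) (X' X Y : C) (f : Hom X' X) (d : D C n X Y) :
  uf_D Phi (D_precomp f d) = D_precomp (fmap Phi f) (uf_D Phi d).
Proof.
elim: n X' X f d => [|n IH] X' X f d /=; first exact: fmapM.
rewrite IH -!D_precompM; apply: D_pair_eq => [|c c1 c2].
  by rewrite /uf_base fmapM compmA.
apply: uf_ext_ext.
- rewrite -!compmA -fmapM uQmap1 uf_iota1 fmapM uQmap1.
  by rewrite !compmA uf_iota1 c1.
- rewrite -(compmA (uf_iota _ _)) -fmapM uQmap2 uf_iota2.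
  by rewrite -!compmA (compmA (uf_iota _ _)) uf_iota2 uQmap2 c2.
Qed.

End UniverseFunctor.

Theorem lemma3p20 (C C' : universe_category)
    (L : lcc_structure C) (B : binary_products C)
    (L' : lcc_structure C') (B' : binary_products C')
    (Phi : universe_functor C C') (n : nat) (X Y : C) (d : D C n X Y) :
  eta L' B' (uf_D Phi d) = fmap Phi (eta L B d) ;; chi Phi L B L' B' n Y.
Proof.
by rewrite -{1}(D_precomp_IdD L B d) uf_D_precomp eta_precomp.
Qed.
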